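(* Let $G$ be a Helly $EPT$ graph and let $h\geq 3$ be an integer. Then $G\in$ Helly $[h,2,2]$ if and only if every atom of $G$ has at most $h$ cliques.
   Context: All graphs are finite and simple. An $EPT$ representation of a graph $G$ is a pair $\langle \mathcal{P},T\rangle$ where $T$ is a tree (the host tree) and $\mathcal{P}=(P_v)_{v\in V(G)}$ is a family of subpaths of $T$ such that two distinct vertices $v,w$ of $G$ are adjacent if and only if $E(P_v)\cap E(P_w)\neq\emptyset$. If the host tree has maximum degree $h$, the representation is an $(h,2,2)$-representation. A representation is Helly if the family $(E(P))_{P\in\mathcal{P}}$ has the Helly property (every pairwise intersecting subfamily has nonempty total intersection). $G$ is Helly $EPT$ if it has a Helly $EPT$ representation, and $G\in$ Helly $[h,2,2]$ if it has a Helly $(h,2,2)$-representation. A clique is a maximal complete set of vertices. A clique $C$ of a connected graph $H$ is a separator if $H-C$ (the subgraph induced by $V(H)\setminus C$) is disconnected. An atom is a connected graph with no clique separator. The atoms of a graph $G$ are the graphs obtained by the decomposition of $G$ by clique separators (Monma–Wei / Tarjan): $G$ is progressively decomposed along clique separators into a clique decomposition tree whose internal nodes correspond to clique separators and whose leaves correspond to atoms; equivalently, the atoms of $G$ are the maximal connected induced subgraphs of $G$ having no clique separator. The atoms of $G$ do not depend on the choice of decomposition. *)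

(* Defs.v *)
(* Finite simple graphs are symmetric irreflexive relations on a finType. *)
From mathcomp Require Import all_boot.
Set Implicit Arguments. Unset Strict Implicit. Unset Printing Implicit Defensive.

Section GraphDefs.
Variable V : finType.
Variable adj : rel V.

Definition complete (K : {set V}) : bool :=
  [forall x in K, forall y in K, (x != y) ==> adj x y].

Definition clique_in (A K : {set V}) : bool :=
  maxset (fun B : {set V} => (B \subset A) && complete B) K.

Definition restr (A : {set V}) : rel V :=
  fun x y => [&& x \in A, y \in A & adj x y].

Definition conn_in (A : {set V}) : bool :=
  [forall x in A, forall y in A, connect (restr A) x y].

Definition connectedb (A : {set V}) : bool := (A != set0) && conn_in A.

Definition clique_sep (A C : {set V}) : bool :=
  clique_in A C && ~~ conn_in (A :\: C).

Definition no_clique_sep (A : {set V}) : bool :=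
  [forall C : {set V}, ~~ clique_sep A C].

Definition atom (A : {set V}) : bool :=
  maxset (fun B : {set V} => connectedb B && no_clique_sep B) A.

Definition ncliques (A : {set V}) : nat := #|[set K : {set V} | clique_in A K]|.

End GraphDefs.

Section TreeDefs.
Variable T : finType.
Variable eT : rel T.

Definition is_tree : Prop :=
  [/\ symmetric eT, irreflexive eT, 0 < #|T|,
      (forall x y, connect eT x y) &
      (forall c : seq T, uniq c -> 3 <= size c -> ~~ cycle eT c)].

Definition max_degree_le (h : nat) : Prop :=
  forall x : T, #|[set y | eT x y]| <= h.

Definition tpath (p : seq T) : bool :=
  if p is x :: q then path eT x q && uniq p else false.

Definition pedges (p : seq T) : {set {set T}} :=
  [set [set x.1; x.2] | x in zip p (behead p)].

End TreeDefs.

Definition ept_rep (V T : finType) (adj : rel V) (eT : rel T) (P : V -> seq T) : Prop :=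
  (forall v, tpath eT (P v)) /\
  (forall u v, u != v -> adj u v = (pedges (P u) :&: pedges (P v) != set0)).

Definition helly_rep (V T : finType) (P : V -> seq T) : Prop :=
  forall S : {set V}, S != set0 ->
    (forall u v, u \in S -> v \in S -> pedges (P u) :&: pedges (P v) != set0) ->
    exists e : {set T}, forall v, v \in S -> e \in pedges (P v).

Definition helly_EPT (V : finType) (adj : rel V) : Prop :=
  exists (T : finType) (eT : rel T) (P : V -> seq T),
    [/\ is_tree eT, ept_rep adj eT P & helly_rep P].

Definition helly_h22 (h : nat) (V : finType) (adj : rel V) : Prop :=
  exists (T : finType) (eT : rel T) (P : V -> seq T),
    [/\ is_tree eT, max_degree_le eT h, ept_rep adj eT P & helly_rep P].

(* Main.v *)
Require Import Defs.
From mathcomp Require Import all_boot.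
From mathcomp Require Import zify.

(** If the tree has maximal degree at most [h], let [A] be connected without
clique separator. By the Helly property each clique [K] of [A] is the set of
paths of [A] on some edge [f K]. The paths of [A] on an arbitrary edge [g] lie
in one clique [K0], and [A - K0] is connected, hence lives on one side of [g];
so at most one [f K] touches the other side. Orienting every edge towards that
richer side, a sink [x] has at most one [f K] in each branch, and [A] has at
most [deg x] cliques.

Conversely, take a vertex [x] of degree [> h] and the graph [H] on its
neighbours whose edges are the pairs used by a common path; it is triangle-free
by the Helly property. If [H - j] is disconnected for some [j], then [x] can be
split into two adjacent vertices of smaller degree, every path on the new edge
using the edge [xj], so that intersections do not change. Otherwise the paths
through [x] induce a connected graph without clique separator whose cliques are
the stars of [H]; this gives an atom with more than [h] cliques. *)

Set Implicit Arguments. Unset Strict Implicit. Unset Printing Implicit Defensive.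

Lemma set2_inj (T : finType) (a b c d : T) :
  [set a; b] = [set c; d] -> (a = c /\ b = d) \/ (a = d /\ b = c).
Proof.
move=> E.
have := set21 a b; rewrite E => /set2P[] ?; have := set22 a b; rewrite E => /set2P[] ?;
have := set21 c d; rewrite -E => /set2P[] ?; have := set22 c d; rewrite -E => /set2P[] ?;
subst; by [left|right].
Qed.

(** * Trees axiomatised by the cuts of their edges *)

Section CutSystems.

Variables (T : finType) (e : rel T).

(** [sd a b] stands for the component of [b] once the edge [ab] is removed. That a cut changes only
    across its own edge is enough to recover acyclicity, so a modified tree can be checked edge by
    edge, without handling cycles. *)
Record cut_system (sd : T -> T -> pred T) : Prop := CutSystem {
  cut_sym : symmetric e;
  cut_irr : irreflexive e;
  cut_gt0 : 0 < #|T|;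
  cut_conn : forall x y, connect e x y;
  cut_src : forall a b, e a b -> sd a b a = false;
  cut_dst : forall a b, e a b -> sd a b b;
  cut_cross : forall a b c d, e a b -> e c d -> sd a b c != sd a b d ->
    (c = a /\ d = b) \/ (c = b /\ d = a) }.

Definition del_edge (a b : T) : rel T :=
  fun x y => e x y && ([set x; y] != [set a; b]).

Definition edge_side (a b : T) : pred T := connect (del_edge a b) b.

(** A simple path from [b] back to [a] that avoids the edge [ab] would close up with it into a cycle
    of length at least 3. *)
Lemma tree_cut_system : is_tree e -> cut_system edge_side.
Proof.
case=> esym eirr T0 econn acyc.
have dsym a b : symmetric (del_edge a b).
  by move=> x y; rewrite /del_edge esym (setUC [set x]).
split=> //.
- move=> a b eab; apply/negP=> /connectP[p0 pth0 lst0].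
  case/shortenP: pth0 lst0 => p pth uq _ lst.
  have eba : e b a by rewrite esym.
  have sz : 3 <= size (b :: p).
    case: p lst pth {uq} => [|c [|d p]] //=.
    - by move=> E; move: eab; rewrite E eirr.
    - by move=> <-; rewrite /del_edge (setUC [set b]) eqxx andbF.
  have /negP := acyc _ uq sz; apply.
  rewrite /= rcons_path -lst eab andbT.
  by apply: sub_path pth => x y /andP[].
- by move=> a b _; exact: connect0.
move=> a b c d eab ecd.
have [E _|ne] := eqVneq [set c; d] [set a; b]; first exact: set2_inj.
rewrite /edge_side (same_connect1r (sym_connect_sym (dsym a b)) (_ : del_edge a b c d)) ?eqxx //.
by rewrite /del_edge ecd.
Qed.

Lemma pedges_cons (x y : T) q :
  pedges (x :: y :: q) = [set x; y] |: pedges (y :: q).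
Proof.
apply/setP=> f; rewrite in_setU1; apply/imsetP/orP.
- case=> -[u v]; rewrite /= inE => /orP[/eqP[-> ->] -> |h ->]; first by left.
  by right; apply/imsetP; exists (u, v).
- case=> [/eqP->|/imsetP[[u v] h ->]]; first by exists (x, y); rewrite //= inE eqxx.
  by exists (u, v) => //=; rewrite inE h orbT.
Qed.

Lemma pedges1 (x : T) : pedges [:: x] = set0.
Proof. by apply/setP=> f; rewrite inE; apply/negP=> /imsetP[]. Qed.

Lemma pedges_mem (x : T) q a b :
  [set a; b] \in pedges (x :: q) -> a \in x :: q.
Proof.
elim: q x => [|y q IH] x; first by rewrite pedges1 inE.
rewrite pedges_cons in_setU1 => /orP[/eqP/set2_inj[[-> _]|[-> _]]|/IH h].
- exact: mem_head.
- by rewrite !inE eqxx orbT.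
- by rewrite in_cons h orbT.
Qed.

Lemma pedges_edge (x : T) q f : path e x q -> f \in pedges (x :: q) ->
  exists a b, e a b /\ f = [set a; b].
Proof.
elim: q x => [|y q IH] x; first by rewrite pedges1 inE.
rewrite pedges_cons in_setU1 /= => /andP[exy pth] /orP[/eqP->|]; first by exists x, y.
exact: IH.
Qed.

Variable sd : T -> T -> pred T.
Hypothesis cs : cut_system sd.

Lemma cut_neq a b c d : e a b -> e c d -> [set c; d] != [set a; b] ->
  sd a b c = sd a b d.
Proof.
move=> eab ecd ne; apply/eqP/negPn/negP=> h.
by case/negP: ne; case: (cut_cross cs eab ecd h) => -[-> ->] //; rewrite setUC.
Qed.

Lemma path_side a b x q y : e a b -> path e x q ->
  [set a; b] \notin pedges (x :: q) -> y \in x :: q -> sd a b y = sd a b x.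
Proof.
move=> eab; elim: q x => [|z q IH] x; first by rewrite inE => _ _ /eqP->.
rewrite /= pedges_cons in_setU1 negb_or => /andP[exz pth] /andP[ne nin].
rewrite in_cons => /orP[/eqP-> //|/(IH _ pth nin)->].
by apply/esym/cut_neq; rewrite // eq_sym.
Qed.

Lemma path_cross a b x q : e a b -> path e x q -> uniq (x :: q) ->
  [set a; b] \in pedges (x :: q) -> sd a b x != sd a b (last x q).
Proof.
move=> eab; elim: q x => [|z q IH] x; first by rewrite pedges1 inE.
rewrite pedges_cons in_setU1 cons_uniq => /andP[exz pth] /andP[xnot uq].
have [E _|ne /= h] := eqVneq [set a; b] [set x; z].
  have nin : [set a; b] \notin pedges (z :: q).
    by apply: contra xnot; rewrite E; exact: pedges_mem.
  rewrite (path_side eab pth nin (mem_last _ _)).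
  case/set2_inj: E => -[<- <-]; rewrite (cut_src cs) // ?(cut_dst cs) //.
have -> : sd a b x = sd a b z by apply: cut_neq; rewrite // eq_sym.
exact: IH.
Qed.

Definition sep u w : rel T := fun a b => e a b && (sd a b u != sd a b w).

Lemma mem_pedges x q a b : path e x q -> uniq (x :: q) ->
  ([set a; b] \in pedges (x :: q)) = sep x (last x q) a b.
Proof.
move=> pth uq; rewrite /sep; case eab: (e a b) => /=.
  apply/idP/idP; first exact: path_cross.
  apply: contraR => nin; rewrite eq_sym; apply/eqP.
  exact: path_side eab pth nin (mem_last _ _).
apply/negP=> /(pedges_edge pth)[c [d [ecd /set2_inj[] [? ?]]]]; subst.
  by rewrite ecd in eab.
by rewrite (cut_sym cs) ecd in eab.
Qed.

Lemma tree_path x y :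
  exists q, [/\ path e x q, uniq (x :: q) & last x q = y].
Proof.
have /connectP[p0 pth0 ->] := cut_conn cs x y.
by case/shortenP: pth0 => p pth uq _; exists p.
Qed.

(** The axioms do not relate the two directions of an edge directly; both cuts are compared with the
    path from [a] to [t], which uses [ab] exactly when [t] lies beyond [b]. *)
Lemma cut_opp a b t : e a b -> sd b a t = ~~ sd a b t.
Proof.
move=> eab; have eba : e b a by rewrite (cut_sym cs).
have [q [pth uq <-]] := tree_path a t.
have := mem_pedges a b pth uq; have := mem_pedges b a pth uq.
rewrite (setUC [set b]) => ->; rewrite /sep eab eba (cut_src cs eab) (cut_dst cs eba).
by case: (sd b a _); case: (sd a b _).
Qed.

Lemma sep_symE u w a b : sep u w b a = sep u w a b.
Proof.
rewrite /sep (cut_sym cs); case eab: (e a b) => //=.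
by rewrite !(cut_opp _ eab); case: (sd a b u); case: (sd a b w).
Qed.

(* Every vertex of the path from [u] to [w] is on the common side of [u] and [w]. *)
Lemma sep_side u w a b c d : e a b -> sd a b u = sd a b w -> sep u w c d ->
  sd a b c = sd a b u.
Proof.
move=> eab; have [q [pth uq <-]] := tree_path u w => E.
rewrite -mem_pedges // => /pedges_mem cq; apply: (path_side eab pth) cq.
by rewrite mem_pedges // /sep E eqxx andbF.
Qed.

(** By contraposition: a path from [x] to [t] that avoids the edge [xy] never reaches [y], so it
    avoids [yz] as well and leaves [t] on the side of [x], away from [z]. *)
Lemma cut_nested x y z t : e x y -> e y z -> z != x -> sd y z t -> sd x y t.
Proof.
move=> exy eyz zx; apply: contraTT => nt.
have [q [pth uq E]] := tree_path x t.
have nin : [set x; y] \notin pedges (x :: q).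
  by rewrite mem_pedges // /sep E (cut_src cs exy) exy (negPf nt).
have nin2 : [set y; z] \notin pedges (x :: q).
  apply/negP=> /pedges_mem /(path_side exy pth nin).
  by rewrite (cut_src cs exy) (cut_dst cs exy).
have -> : sd y z t = sd y z x by rewrite -E; apply: path_side eyz pth nin2 (mem_last _ _).
rewrite (@cut_neq y z x y) ?(cut_src cs eyz) //.
have nxy : x != y by apply/eqP=> h; rewrite h (cut_irr cs) in exy.
apply/eqP=> /set2_inj[[h _]|[h _]]; first by rewrite h eqxx in nxy.
by rewrite h eqxx in zx.
Qed.

Lemma branch_disjoint x y z t : e x y -> e x z -> y != z -> sd x y t -> sd x z t = false.
Proof.
move=> exy exz yz h; apply/negbTE; have ezx : e z x by rewrite (cut_sym cs).
by rewrite -cut_opp //; apply: (cut_nested ezx exy).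
Qed.

Lemma branch_exists x t : t != x -> exists2 y, e x y & sd x y t.
Proof.
have [[|y q] [pth uq <-]] := tree_path x t; first by rewrite eqxx.
have exy : e x y by case/andP: pth.
move=> _; exists y => //; have := mem_pedges x y pth uq.
by rewrite pedges_cons setU11 /sep exy (cut_src cs exy); case: (sd x y _).
Qed.

(** In a cycle through [ab], the remaining vertices are joined to [b] without using [ab], so they
    lie on the side of [b]. The closing edge into [a] then crosses the cut of [ab] without being
    [ab]. *)
Lemma cut_system_tree : is_tree e.
Proof.
split; [exact: cut_sym cs|exact: cut_irr cs|exact: cut_gt0 cs|exact: cut_conn cs|].
case=> [|a [|b [|c r]]] //= /and3P[]; rewrite !inE !negb_or => /and3P[ab ac ar].
move=> /andP[bc br] _ _; apply/negP=> /and3P[eab ebc].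
rewrite rcons_path => /andP[pth la].
have sdb : sd a b (last c r) = sd a b b.
  apply: (@path_side a b b (c :: r)) => //=; first by rewrite ebc.
    by apply/negP=> /pedges_mem; rewrite !inE (negPf ab) (negPf ac) (negPf ar).
  by rewrite in_cons mem_last orbT.
have := cut_cross cs eab la; rewrite sdb (cut_dst cs eab) (cut_src cs eab).
case=> // -[E _]; have := mem_last c r; rewrite E inE ?(negPf ab) ?(negPf ac) ?(negPf ar) //.
by rewrite (negPf bc) (negPf br).
Qed.

End CutSystems.

(** * Paths and representations in terms of cuts *)

Definition on (V T : finType) (e : rel T) (sd : T -> T -> pred T) (al be : V -> T) (v : V) : rel T :=
  sep e sd (al v) (be v).

Definition meets (V T : finType) (e : rel T) (sd : T -> T -> pred T) (al be : V -> T) (u v : V) : Prop :=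
  exists a b, on e sd al be u a b /\ on e sd al be v a b.

(* The path of a vertex [v] is encoded by its endpoints [al v] and [be v]: its
   edges are those whose cut separates the endpoints. *)
Record cut_rep (V T : finType) (adj : rel V) (e : rel T)
    (sd : T -> T -> pred T) (al be : V -> T) : Prop := CutRep {
  rep_cut : cut_system e sd;
  rep_adj : forall u v, u != v -> adj u v <-> meets e sd al be u v;
  rep_helly : forall S : {set V}, S != set0 ->
    (forall u v, u \in S -> v \in S -> meets e sd al be u v) ->
    exists a b, forall v, v \in S -> on e sd al be v a b }.

Lemma cut_rep_of_tree (V T : finType) (adj : rel V) (e : rel T) (P : V -> seq T) :
  is_tree e -> ept_rep adj e P -> helly_rep P ->
  exists sd al be, cut_rep adj e sd al be.
Proof.
move=> tr [tp adjP] helly.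
have T0 : 0 < #|T| by case: tr.
have [x0 _] := card_gt0P T0.
have cs := tree_cut_system tr.
pose al v := head x0 (P v); pose be v := last x0 (P v).
exists (edge_side e), al, be.
have onE v a b : ([set a; b] \in pedges (P v)) = on e (edge_side e) al be v a b.
  rewrite /on /al /be; have := tp v; case: (P v) => [|x q] //= /andP[pth uq].
  exact: (mem_pedges cs).
have edgeP v f : f \in pedges (P v) -> exists a b, f = [set a; b].
  have := tp v; case: (P v) => [|x q] //= /andP[pth _] /(pedges_edge pth)[a [b []]].
  by exists a, b.
have meetsP u v : reflect (meets e (edge_side e) al be u v)
    (pedges (P u) :&: pedges (P v) != set0).
  apply: (iffP (set0Pn _)) => [[f /setIP[fu fv]]|[a [b [ha hb]]]].
    have [a [b E]] := edgeP _ _ fu; exists a, b.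
    by rewrite -!onE -E.
  by exists [set a; b]; rewrite inE !onE ha.
split=> // [u v uv|S S0 pS]; first by rewrite adjP //; split=> /meetsP.
have [|f fP] := helly S S0; first by move=> u v uS vS; apply/meetsP/pS.
have [v0 v0S] := set0Pn _ S0.
have [a [b E]] := edgeP _ _ (fP _ v0S).
by exists a, b => v vS; rewrite -onE -E fP.
Qed.

Lemma tree_of_cut_rep (V T : finType) (adj : rel V) (e : rel T)
    (sd : T -> T -> pred T) (al be : V -> T) : cut_rep adj e sd al be ->
  is_tree e /\ exists P, ept_rep adj e P /\ helly_rep P.
Proof.
case=> cs adjP helly; split; first exact: cut_system_tree cs.
have pathb v : exists q, [&& path e (al v) q, uniq (al v :: q) & last (al v) q == be v].
  by have [q [p1 p2 /eqP p3]] := tree_path cs (al v) (be v); exists q; apply/and3P.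
pose P v := al v :: xchoose (pathb v).
have tp v : tpath e (P v).
  by have /and3P[p1 p2 p3] := xchooseP (pathb v); apply/andP.
have onE v a b : ([set a; b] \in pedges (P v)) = on e sd al be v a b.
  have /and3P[p1 p2 /eqP p3] := xchooseP (pathb v).
  by rewrite (mem_pedges cs) // /on -[in RHS]p3.
have meetsP u v : reflect (meets e sd al be u v)
    (pedges (P u) :&: pedges (P v) != set0).
  apply: (iffP (set0Pn _)) => [[f /setIP[fu fv]]|[a [b [ha hb]]]].
    have /andP[p1 _] := tp u; have [a [b [_ E]]] := pedges_edge p1 fu.
    by exists a, b; rewrite -!onE -E.
  by exists [set a; b]; rewrite inE !onE ha.
exists P; split.
  by split=> // u v uv; apply/idP/idP => [/(adjP _ _ uv)|] /meetsP // /(adjP _ _ uv).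
move=> S S0 pS; have [|a [b ab]] := helly S S0.
  by move=> u v uS vS; apply/meetsP/pS.
by exists [set a; b] => v /ab; rewrite onE.
Qed.

(** If every vertex had an outgoing edge that is not [small], one whose far side is smallest would
    be followed by another with a strictly smaller far side. *)
Lemma orientation_sink (T : finType) (e : rel T) sd (small : rel T) :
  cut_system e sd -> (forall a b, e a b -> small a b || small b a) ->
  exists x, forall y, e x y -> small x y.
Proof.
move=> cs orient.
case: (boolP [exists x, forall y, e x y ==> small x y]) => [/existsP[x /forallP h]|].
  by exists x => y; apply/implyP/h.
rewrite negb_exists => /forallP bad.
have out x : exists y, e x y && ~~ small x y.
  by have := bad x; rewrite negb_forall => /existsP[y]; rewrite negb_imply; exists y.
have [x0 _] := card_gt0P (cut_gt0 cs); have [y0 h0] := out x0.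
case: (@arg_minnP _ (x0, y0) (fun p => e p.1 p.2 && ~~ small p.1 p.2)
         (fun p => #|sd p.1 p.2|) h0) => -[x y] /= /andP[exy nxy] min.
have [z /andP[eyz nyz]] := out y.
(* Turning back is impossible: one of the two directions of an edge is [small]. *)
have zx : z != x.
  apply/eqP=> E; have := orient _ _ exy.
  by rewrite (negPf nxy) -E (negPf nyz).
have := min (y, z); rewrite /= eyz nyz => /(_ isT); rewrite leqNgt => /negP[].
apply/proper_card/properP; split.
  by apply/subsetP=> t; exact: (cut_nested cs exy eyz zx).
exists y; first exact: (cut_dst cs exy).
by apply/negP; rewrite /in_mem /= (cut_src cs eyz).
Qed.

(** * Cliques of induced subgraphs *)

Lemma clique_inP (V : finType) (adj : rel V) (A K : {set V}) :
  clique_in adj A K ->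
  [/\ K \subset A,
      forall u v, u \in K -> v \in K -> u != v -> adj u v &
      forall B : {set V}, B \subset A -> complete adj B -> K \subset B -> B = K].
Proof.
move=> /maxsetP[/andP[KA /forall_inP cK] mK]; split=> //.
  by move=> u v /cK/forall_inP h /h /implyP.
by move=> B BA cB; apply: mK; rewrite BA cB.
Qed.

Lemma clique_in_exists (V : finType) (adj : rel V) (A B : {set V}) :
  B \subset A -> complete adj B -> exists2 K, clique_in adj A K & B \subset K.
Proof.
move=> BA cB.
have h : (B \subset A) && complete adj B by rewrite BA.
have [K] := @maxset_exists _ (fun B : {set V} => (B \subset A) && complete adj B) _ h.
by exists K.
Qed.

Lemma completeI (V : finType) (adj : rel V) (K : {set V}) :
  (forall u v, u \in K -> v \in K -> u != v -> adj u v) -> complete adj K.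
Proof.
by move=> h; apply/forall_inP=> u uK; apply/forall_inP=> v vK; apply/implyP/h.
Qed.

Lemma ncliques_set1 (V : finType) (adj : rel V) (u : V) : ncliques adj [set u] <= 1.
Proof.
apply: (@leq_trans #|[set [set u]]|); last by rewrite cards1.
apply/subset_leq_card/subsetP=> K; rewrite !inE => /clique_inP[KA _ mK].
apply/eqP/esym/mK => //; apply: completeI => x y /set1P-> /set1P->.
by rewrite eqxx.
Qed.

(** Every clique of [A] is the trace on [A] of a clique of [B] that extends it. *)
Lemma ncliquesS (V : finType) (adj : rel V) (A B : {set V}) :
  A \subset B -> ncliques adj A <= ncliques adj B.
Proof.
move=> AB.
apply: leq_trans (leq_imset_card (fun K => K :&: A) _).
apply/subset_leq_card/subsetP=> K; rewrite inE => KA.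
have [sKA cK mK] := clique_inP KA.
have [L LB KL] := clique_in_exists (subset_trans sKA AB) (completeI cK).
have [_ cL _] := clique_inP LB.
apply/imsetP; exists L; first by rewrite inE.
apply/esym/mK; [exact: subsetIr| |by rewrite subsetI KL].
by apply: completeI => u v /setIP[uL _] /setIP[vL _]; apply: cL.
Qed.

(** * Cliques of a connected graph without clique separator *)

Section NoCliqueSeparator.

Variables (V T : finType) (adj : rel V) (e : rel T).
Variables (sd : T -> T -> pred T) (al be : V -> T).
Hypothesis adjI : irreflexive adj.
Hypothesis rep : cut_rep adj e sd al be.

Notation on := (on e sd al be).
Notation meets := (meets e sd al be).
Let cs := rep_cut rep.

Lemma meets_side u v a b : e a b -> ~~ on u a b -> ~~ on v a b -> meets u v ->
  sd a b (al u) = sd a b (al v).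
Proof.
rewrite /on /sep => eab; rewrite eab /= !negbK => /eqP hu /eqP hv [c [d [cu cv]]].
by rewrite -(sep_side cs eab hu cu) (sep_side cs eab hv cv).
Qed.

Lemma on_complete (A : {set V}) a b :
  complete adj [set v in A | on v a b].
Proof.
apply: completeI => u v; rewrite !inE => /andP[_ hu] /andP[_ hv] uv.
by apply/(rep_adj rep uv); exists a, b.
Qed.

(** The first hypothesis excludes paths without edges, whose vertex is isolated and forms a clique
    that no edge carries. Maximality of [K] turns its inclusion in the paths on the Helly edge into
    an equality. *)
Lemma clique_edge (A K : {set V}) : (forall u, u \in A -> meets u u) ->
  A != set0 -> clique_in adj A K ->
  exists a b, e a b /\ K = [set v in A | on v a b].
Proof.
move=> mA /set0Pn[u0 u0A] KA; have [sKA cK mK] := clique_inP KA.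
have K0 : K != set0.
  apply/negP=> /eqP K0; have : [set u0] = K.
    apply: mK; rewrite ?sub1set ?K0 ?sub0set //.
    by apply: completeI => x y /set1P-> /set1P->; rewrite eqxx.
  by move/setP/(_ u0); rewrite K0 !inE eqxx.
have [|a [b ab]] := rep_helly rep K0.
  move=> u v uK vK; have [->|uv] := eqVneq u v.
    by apply: mA; apply: (subsetP sKA).
  by apply/(rep_adj rep uv)/cK.
have [v0 /ab v0K] := set0Pn _ K0; have /andP[eab _] := v0K.
exists a, b; split=> //; apply/esym/mK; last first.
- by apply/subsetP=> v vK; rewrite inE (subsetP sKA) ?ab.
- exact: on_complete.
- by apply/subsetP=> v; rewrite inE => /andP[].
Qed.

Lemma ncliques_le_degree (A : {set V}) :
  connectedb adj A -> no_clique_sep adj A -> 1 < ncliques adj A ->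
  exists x, ncliques adj A <= #|[set y | e x y]|.
Proof.
move=> /andP[A0 /forall_inP conA] /forallP nosep many.
(* More than one clique forces a second vertex in [A]; connectivity then gives [u] a neighbour, so
   its path has an edge. *)
have mA u : u \in A -> meets u u.
  move=> uA; have [w wA wu] : exists2 w, w \in A & w != u.
    apply/exists_inP; apply: contraLR many; rewrite negb_exists_in -leqNgt => /forall_inP h.
    suff -> : A = [set u] by exact: ncliques_set1.
    apply/setP=> x; rewrite inE; apply/idP/eqP => [xA|->//].
    by apply/eqP; have := h x xA; rewrite negbK.
  have /connectP[[|y q] /=] := forall_inP (conA u uA) w wA.
    by move=> _ E; rewrite E eqxx in wu.
  move=> /andP[/and3P[_ _ uy] _] _.
  have ne : u != y by apply: contraTneq uy => <-; rewrite adjI.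
  by have /(rep_adj rep ne) [a [b [h _]]] := uy; exists a, b.
have [x0 _] := card_gt0P (cut_gt0 cs).
pose f (K : {set V}) := odflt (x0, x0)
  [pick p | e p.1 p.2 && (K == [set v in A | on v p.1 p.2])].
have fP K : clique_in adj A K -> e (f K).1 (f K).2 /\ K = [set v in A | on v (f K).1 (f K).2].
  move=> /(clique_edge mA A0)[a [b [eab KE]]]; rewrite /f.
  case: pickP => [p /andP[h /eqP h2] //|/(_ (a, b))] /=.
  by rewrite eab KE eqxx.
pose touch x y K := sd x y (f K).1 || sd x y (f K).2.
pose small x y := [exists K0, forall K, clique_in adj A K ==> touch x y K ==> (K == K0)].
have orient a b : e a b -> small a b || small b a.
  move=> eab.
  have [|K0 K0A onK0] := @clique_in_exists V adj A _ _ (on_complete A a b).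
    by apply/subsetP=> v; rewrite inE => /andP[].
  have [_ _ mK0] := clique_inP K0A.
  have noton v : v \in A :\: K0 -> ~~ on v a b.
    rewrite inE => /andP[vK0 vA]; apply: contra vK0 => h.
    by apply: (subsetP onK0); rewrite inE vA.
  have con : conn_in adj (A :\: K0).
    by have := nosep K0; rewrite /clique_sep K0A /= negbK.
  (* Adjacent vertices outside [K0] share an edge while both avoid [ab], so a walk in the connected
     rest never changes side. *)
  have sideE u v : u \in A :\: K0 -> v \in A :\: K0 -> sd a b (al u) = sd a b (al v).
    move=> uA vA; have /connectP[q pth ->] := forall_inP (forall_inP con u uA) v vA.
    elim: q u pth {uA vA} => [|w q IH] u //= /andP[/and3P[uA wA uw] /IH <-].
    have ne : u != w by apply: contraTneq uw => <-; rewrite adjI.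
    by apply: meets_side; rewrite ?noton //; apply/(rep_adj rep ne).
  (* A clique other than [K0] has a vertex [w] outside [K0]; the edge chosen for that clique is on
     the path of [w], hence on the common side of the vertices outside [K0]. *)
  have touchE K v : clique_in adj A K -> K != K0 -> v \in A :\: K0 ->
      (touch a b K = sd a b (al v)) /\ touch b a K = ~~ sd a b (al v).
    move=> KA KK0 vA; have [sKA cK mK] := clique_inP KA.
    have [w wK wK0] : exists2 w, w \in K & w \notin K0.
      apply/subsetPn; apply: contra KK0 => KK0; apply/eqP/esym/mK => //.
        by case: (clique_inP K0A).
      by apply: completeI; case: (clique_inP K0A).
    have wA : w \in A :\: K0 by rewrite inE wK0 (subsetP sKA).
    have [eK KE] := fP _ KA.
    have wf : on w (f K).1 (f K).2 by move: wK; rewrite {1}KE inE => /andP[].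
    have wab : sd a b (al w) = sd a b (be w).
      by apply/eqP; move: (noton _ wA); rewrite /on /sep eab /= negbK.
    have s1 := sep_side cs eab wab wf.
    have s2 : sd a b (f K).2 = sd a b (al w).
      by apply: (sep_side cs eab wab (d := (f K).1)); rewrite (sep_symE cs).
    by rewrite /touch !(cut_opp cs _ eab) s1 s2 orbb orbb (sideE w v).
  (* If [K0] is all of [A], it is the only clique and either direction would do. *)
  have [v vA|none] := pickP [in A :\: K0]; last first.
    apply/orP; left; apply/existsP; exists K0; apply/forall_inP=> K KA.
    apply/implyP=> _; have [sKA cK mK] := clique_inP KA.
    apply/eqP/esym/mK; [by case: (clique_inP K0A)|by apply: completeI; case: (clique_inP K0A)|].
    apply/subsetP=> w /(subsetP sKA) wA; have := none w; rewrite /= inE wA andbT.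
    by move/negbT; rewrite negbK.
  case: (boolP (sd a b (al v))) => sv; apply/orP; [right|left];
    apply/existsP; exists K0; apply/forall_inP=> K KA; apply/implyP; apply: contraTT => KK0;
    by have [t1 t2] := touchE K v KA KK0 vA; rewrite ?t1 ?t2 ?sv ?negbK.
have [x xP] := orientation_sink cs orient.
exists x.
(* Each clique is recovered from a branch at the sink that its edge reaches; such a branch exists
   because one end of the edge differs from [x]. *)
pose g y := odflt set0 [pick K | clique_in adj A K && touch x y K].
apply: leq_trans (leq_imset_card g _).
apply/subset_leq_card/subsetP=> K; rewrite inE => KA.
have [eK _] := fP _ KA.
have [y exy tK] : exists2 y, e x y & touch x y K.
  have [E|ne] := eqVneq (f K).1 x; last first.
    by have [y exy h] := branch_exists cs ne; exists y => //; rewrite /touch h.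
  have [|y exy h] := @branch_exists _ _ _ cs x (f K).2.
    by apply: contraTneq eK => ->; rewrite E (cut_irr cs).
  by exists y => //; rewrite /touch h orbT.
apply/imsetP; exists y; first by rewrite inE.
have /existsP[K0 /forall_inP h] := xP y exy.
rewrite /g; case: pickP => [L /andP[LA tL]|/(_ K)]; last by rewrite KA tK.
by rewrite (eqP (implyP (h K KA) tK)) (eqP (implyP (h L LA) tL)).
Qed.

End NoCliqueSeparator.

(** * Paths through a vertex that cannot be split *)

Section Star.

Variables (V T : finType) (adj : rel V) (e : rel T).
Variables (sd : T -> T -> pred T) (al be : V -> T).
Hypothesis rep : cut_rep adj e sd al be.

Notation on := (on e sd al be).
Notation meets := (meets e sd al be).
Let cs := rep_cut rep.

Variable x : T.
Let N := [set y | e x y].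

(* [C] is a union of components of [H - j], where [H] is the graph on the
   neighbours of [x] joining the pairs used by a common path through [x]. *)
Definition splits (j : T) (C : {set T}) : bool :=
  [&& j \in N, C \subset N :\ j, C != set0, (N :\ j) :\: C != set0 &
    [forall c in C, forall c' in (N :\ j) :\: C, forall v, ~~ (on v x c && on v x c')]].

(** Each branch used contains exactly one of the two end vertices of the path, and branches are
    disjoint. *)
Lemma at_most_two v c c' c'' : c != c' -> on v x c -> on v x c' -> on v x c'' ->
  c'' = c \/ c'' = c'.
Proof.
move=> ne /andP[e1 h1] /andP[e2 h2] /andP[e3 h3].
have [->|n1] := eqVneq c'' c; first by left.
have [->|n2] := eqVneq c'' c'; first by right.
have d1 t := @branch_disjoint _ _ _ cs x c c' t e1 e2 ne.
have d2 t := @branch_disjoint _ _ _ cs x c'' c t e3 e1 n1.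
have d3 t := @branch_disjoint _ _ _ cs x c'' c' t e3 e2 n2.
exfalso; move: (d1 (al v)) (d2 (al v)) (d3 (al v)) (d1 (be v)) (d2 (be v)) (d3 (be v)) h1 h2 h3.
case: (sd x c (al v)); case: (sd x c' (al v)); case: (sd x c'' (al v));
case: (sd x c (be v)); case: (sd x c' (be v)); case: (sd x c'' (be v)); intuition.
Qed.

Definition through : {set V} :=
  [set v | [exists c, exists c', [&& c != c', on v x c & on v x c']]].

Lemma throughP v : reflect (exists c c', [/\ c != c', on v x c & on v x c'])
  (v \in through).
Proof.
rewrite inE; apply: (iffP existsP) => [[c /existsP[c' /and3P[]]]|[c [c' [h1 h2 h3]]]].
  by exists c, c'.
by exists c; apply/existsP; exists c'; rewrite h1 h2 h3.
Qed.

(** A path that contains [x] and avoids the edge [xm] stays on the side of [x], so none of its edges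
    reaches the branch of [m]. *)
Lemma through_branch v a b m : v \in through -> e x m -> on v a b ->
  sd x m a || sd x m b -> on v x m.
Proof.
move=> /throughP[c [_ [_ hc _]]] exm ab; apply: contraLR.
rewrite {1}/on /sep exm /= negbK negb_or => /eqP E.
have sdx : sd x m x = sd x m (al v) := sep_side cs exm E hc.
rewrite (sep_side cs exm E ab) (sep_side cs exm E (d := a)); last first.
  by rewrite (sep_symE cs).
by rewrite -sdx (cut_src cs).
Qed.

Lemma edge_branch a b : e a b -> exists2 m, e x m & sd x m a || sd x m b.
Proof.
move=> eab; have [E|ne] := eqVneq a x; last first.
  by have [y exy h] := branch_exists cs ne; exists y => //; rewrite h.
have [|y exy h] := @branch_exists _ _ _ cs x b.
  by apply: contraTneq eab => ->; rewrite E (cut_irr cs).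
by exists y => //; rewrite h orbT.
Qed.

(** A shared edge reaches some branch, and both paths can enter it only from [x]. *)
Lemma meets_through u v : u \in through -> v \in through -> meets u v ->
  exists2 m, on u x m & on v x m.
Proof.
move=> uB vB [a [b [ua vb]]]; have [m exm h] := edge_branch (proj1 (andP ua)).
by exists m; [apply: through_branch ua h|apply: through_branch vb h].
Qed.

Hypothesis N4 : 3 < #|N|.
Hypothesis nosplit : forall j C, ~~ splits j C.

Lemma onN v c : on v x c -> c \in N.
Proof. by case/andP=> h _; rewrite inE. Qed.

Lemma cross j (C : {set T}) : j \in N -> C \subset N :\ j -> C != set0 ->
  (N :\ j) :\: C != set0 ->
  exists c c' v, [/\ c \in C, c' \in (N :\ j) :\: C, on v x c & on v x c'].
Proof.
move=> jN CN C0 D0; have := nosplit j C.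
rewrite /splits jN CN C0 D0 /= negb_forall_in => /exists_inP[c cC].
rewrite negb_forall_in => /exists_inP[c' cC'].
rewrite negb_forall => /existsP[v]; rewrite negbK => /andP[h1 h2].
by exists c, c', v.
Qed.

Lemma cross1 c j : c \in N -> j \in N -> j != c ->
  exists c' v, [/\ c' != c, c' != j, on v x c & on v x c'].
Proof.
move=> cN jN jc.
have [|||d [c' [v [/set1P-> h1 h2 h3]]]] := @cross j [set c] jN.
- by rewrite sub1set !inE eq_sym jc -[e x c]in_set.
- by apply/set0Pn; exists c; rewrite set11.
- rewrite -card_gt0; have := cardsD1 j N; have := cardsD1 c (N :\ j).
  by rewrite jN !inE eq_sym jc -[e x c]in_set cN; lia.
by exists c', v; move: h1; rewrite !inE => /and3P[? ? _].
Qed.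

(** Deleting an arbitrary [j] from [H] leaves [c] a neighbour [c1]; deleting [c1] in turn leaves it
    a second one. *)
Lemma two_neighbours c : c \in N -> exists c1 c2 v1 v2,
  [/\ c1 != c, c2 != c & c1 != c2] /\
  [/\ on v1 x c, on v1 x c1, on v2 x c & on v2 x c2].
Proof.
move=> cN; have [j jN jc] : exists2 j, j \in N & j != c.
  have /set0Pn[j] : N :\ c != set0.
    by rewrite -card_gt0; have := cardsD1 c N; rewrite cN; lia.
  by rewrite !inE => /andP[h1 h2]; exists j; rewrite ?inE.
have [c1 [v1 [n1 _ h1 h2]]] := cross1 cN jN jc.
have [c2 [v2 [n2 n3 h3 h4]]] := cross1 cN (onN h2) n1.
by exists c1, c2, v1, v2; rewrite n1 n2 eq_sym n3.
Qed.

Definition star m : {set V} := [set v in through | on v x m].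

(** If distinct [c] and [d] had the same star, every neighbour of [c] in [H] would be [d], while [c]
    has two of them. *)
Lemma star_inj : {in N &, injective star}.
Proof.
move=> c d cN dN E; apply/eqP; apply: contraT => cd.
have [c1 [c2 [v1 [v2 [[n1 n2 n3] [h1 h2 h3 h4]]]]]] := two_neighbours cN.
have key v k : k != c -> on v x c -> on v x k -> k = d.
  move=> kc hc hk; have : v \in star c.
    by rewrite inE hc andbT; apply/throughP; exists c, k; rewrite eq_sym.
  rewrite E inE => /andP[_ hd].
  have ck : c != k by rewrite eq_sym.
  by have [F|//] := at_most_two ck hc hk hd; rewrite F eqxx in cd.
by rewrite (key _ _ n1 h1 h2) (key _ _ n2 h3 h4) eqxx in n3.
Qed.

(** A vertex [u] adjacent to the whole star but not in it must meet a path on [{c, c1}] at [c1] and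
    one on [{c, c2}] at [c2]; the three paths then intersect pairwise, and the Helly property is
    contradicted. *)
Lemma star_clique c : c \in N -> clique_in adj through (star c).
Proof.
move=> cN; have sB : star c \subset through by apply/subsetP=> v; rewrite inE => /andP[].
have [K KB sK] := clique_in_exists sB (on_complete rep through x c).
suff -> : star c = K by [].
apply/eqP; rewrite eqEsubset sK; apply/subsetP=> u uK.
have [KsB cK _] := clique_inP KB; have uB := subsetP KsB _ uK.
have [c1 [c2 [v1 [v2 [[n1 n2 n3] [h1 h2 h3 h4]]]]]] := two_neighbours cN.
have inS v k : k != c -> on v x c -> on v x k -> v \in star c.
  by move=> kc hc hk; rewrite inE hc andbT; apply/throughP; exists c, k; rewrite eq_sym.
have s1 := inS _ _ n1 h1 h2; have s2 := inS _ _ n2 h3 h4.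
rewrite inE uB /=; apply: contraT => nuc.
have key v k : k != c -> on v x c -> on v x k -> on u x k.
  move=> kc hc hk; have vS := inS v k kc hc hk.
  have uv : u != v by apply: contraNneq nuc => ->.
  have vB := subsetP sB _ vS.
  have [m um vm] := meets_through uB vB ((rep_adj rep uv).1 (cK _ _ uK (subsetP sK _ vS) uv)).
  have ck : c != k by rewrite eq_sym.
  have [F|<-//] := at_most_two ck hc hk vm.
  by rewrite F (negPf nuc) in um.
have u1 := key _ _ n1 h1 h2; have u2 := key _ _ n2 h3 h4.
(* [u], [v1], [v2] use the pairs {c1, c2}, {c, c1}, {c, c2}: a triangle. *)
have [||a [b ab]] := @rep_helly _ _ _ _ _ _ _ rep [set u; v1; v2].
- by apply/set0Pn; exists u; rewrite !inE eqxx.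
- move=> w w'; rewrite !inE => /orP[/orP[]|] /eqP-> /orP[/orP[]|] /eqP->;
  by [exists x, c|exists x, c1|exists x, c2].
have ua : on u a b by apply: ab; rewrite !inE eqxx.
have v1a : on v1 a b by apply: ab; rewrite !inE eqxx orbT.
have v2a : on v2 a b by apply: ab; rewrite !inE eqxx !orbT.
(* The Helly edge may be far from [x]; the edge at [x] leading to its branch is then also common to
   the three paths, which a triangle excludes. *)
have [m exm hm] := edge_branch (proj1 (andP ua)).
have um := through_branch uB exm ua hm.
have v1m := through_branch (subsetP sB _ s1) exm v1a hm.
have v2m := through_branch (subsetP sB _ s2) exm v2a hm.
have c1c : c != c1 by rewrite eq_sym.
have c2c : c != c2 by rewrite eq_sym.
have [F|F] := at_most_two c1c h1 h2 v1m; first by rewrite -F um in nuc.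
have [F'|F'] := at_most_two c2c h3 h4 v2m; first by rewrite -F' um in nuc.
by rewrite -F -F' eqxx in n3.
Qed.

Lemma clique_star K : through != set0 -> clique_in adj through K ->
  exists2 c, c \in N & K = star c.
Proof.
move=> B0 KB.
have [|a [b [eab KE]]] := @clique_edge _ _ _ _ _ _ _ rep through K _ B0 KB.
  by move=> u /throughP[c [_ [_ h _]]]; exists x, c.
have [m exm h] := edge_branch eab; exists m; first by rewrite inE.
have [_ _ mK] := clique_inP KB.
apply/esym/mK; [by apply/subsetP=> v; rewrite inE => /andP[]|exact: on_complete|].
apply/subsetP=> v; rewrite KE inE => /andP[vB ab].
by rewrite inE vB (through_branch vB exm ab h).
Qed.

Lemma connect_shared (A : {set V}) u v c : u \in A -> v \in A -> on u x c -> on v x c ->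
  connect (restr adj A) u v.
Proof.
move=> uA vA hu hv; have [->|uv] := eqVneq u v; first exact: connect0.
by apply: connect1; rewrite /restr uA vA; apply/(rep_adj rep uv); exists x, c.
Qed.

(** The trace on [H] of the component of [u]. A path of [A] using one neighbour in this set has all
    its neighbours of [x] there, so an edge of [H] leaving the set cannot come from [A]. *)
Definition reach (A : {set V}) u : {set T} :=
  [set k in N | [exists w in A, on w x k && connect (restr adj A) u w]].

Lemma reachP (A : {set V}) u k :
  reflect (exists w, [/\ w \in A, on w x k & connect (restr adj A) u w]) (k \in reach A u).
Proof.
rewrite inE; apply: (iffP andP) => [[_ /exists_inP[w wA /andP[h1 h2]]]|[w [wA h1 h2]]].
  by exists w.
by rewrite (onN h1); split=> //; apply/exists_inP; exists w; rewrite ?h1.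
Qed.

Lemma reach_step (A : {set V}) u v c c' : v \in A -> on v x c -> on v x c' ->
  c \in reach A u -> c' \in reach A u.
Proof.
move=> vA hc hc' /reachP[w [wA hw uw]]; apply/reachP; exists v; split=> //.
exact: connect_trans uw (connect_shared wA vA hw hc).
Qed.

Lemma reach_self (A : {set V}) u c : u \in A -> on u x c -> c \in reach A u.
Proof. by move=> uA h; apply/reachP; exists u; rewrite connect0. Qed.

Lemma reach_connect (A : {set V}) u v c : v \in A -> on v x c -> c \in reach A u ->
  connect (restr adj A) u v.
Proof.
by move=> vA hv /reachP[w [wA hw uw]]; apply: connect_trans uw (connect_shared wA vA hw hv).
Qed.

Lemma conn_through : conn_in adj through.
Proof.
apply/forall_inP=> u uB; apply/forall_inP=> v vB.
have /throughP[c [c1 [cc1 hc hc1]]] := uB.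
have /throughP[m [_ [_ hm _]]] := vB.
apply: (reach_connect vB hm); apply: contraT => nm.
have rc := reach_self uB hc; have rc1 := reach_self uB hc1.
have mc : m != c by apply: contraNneq nm => ->.
(* The deleted neighbour is [c], already reached: [c1] and [m] then remain on different sides in
   [H - c]. *)
have [|||k [k' [w [hk hk' wk wk']]]] := @cross c (reach through u :\ c) (onN hc).
- by apply: setSD; apply/subsetP=> k; rewrite inE => /andP[].
- by apply/set0Pn; exists c1; rewrite in_setD1 eq_sym cc1.
- by apply/set0Pn; exists m; rewrite !in_setD !in_set1 mc (negPf nm) (onN hm).
move: hk hk'; rewrite !in_setD !in_set1 => /andP[_ rk] /and3P[nk' k'c k'N].
rewrite k'c /= in nk'.
have wB : w \in through.
  by apply/throughP; exists k, k'; split=> //; apply: contraNneq nk' => <-.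
case/negP: nk'; exact: (reach_step wB wk wk' rk).
Qed.

(** Removing the star of [j] leaves the edges of [H - j]: a path on two neighbours other than [j]
    cannot use [xj] as well. *)
Lemma conn_star j : j \in N -> conn_in adj (through :\: star j).
Proof.
move=> jN; set A := through :\: star j.
have AP w : w \in A -> w \in through /\ ~~ on w x j.
  by rewrite in_setD inE => /andP[h wB]; move: h; rewrite wB.
apply/forall_inP=> u uA; apply/forall_inP=> v vA.
have [uB uj] := AP u uA; have [vB vj] := AP v vA.
have /throughP[c [_ [_ hc _]]] := uB.
have /throughP[m [_ [_ hm _]]] := vB.
apply: (reach_connect vA hm); apply: contraT => nm.
have rj : j \notin reach A u.
  by apply/negP=> /reachP[w [/AP[_ /negP]]].
have [|||k [k' [w [hk hk' wk wk']]]] := @cross j (reach A u) jN.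
- apply/subsetP=> k rk; rewrite in_setD1; apply/andP; split.
    by apply: contraNneq rj => <-.
  by move: rk; rewrite inE => /andP[].
- by apply/set0Pn; exists c; apply: reach_self.
- apply/set0Pn; exists m; rewrite in_setD nm in_setD1 (onN hm) andbT.
  by apply: contraNneq vj => <-.
move: hk'; rewrite in_setD in_setD1 => /and3P[nk' k'j k'N].
have kk' : k != k' by apply: contraNneq nk' => <-.
suff wA : w \in A by case/negP: nk'; exact: (reach_step wA wk wk' hk).
rewrite in_setD; apply/andP; split; last by apply/throughP; exists k, k'.
rewrite inE negb_and; apply/orP; right; apply/negP=> wj.
have [F|F] := at_most_two kk' wk wk' wj; first by rewrite F hk in rj.
by rewrite F eqxx in k'j.
Qed.

(** Maximality is left aside here: an atom containing this set has at least as many cliques. *)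
Lemma star_atom : [/\ connectedb adj through, no_clique_sep adj through &
  #|N| <= ncliques adj through].
Proof.
have B0 : through != set0.
  have /card_gt0P[c cN] : 0 < #|N| by lia.
  have [c1 [c2 [v1 [v2 [[n1 n2 n3] [h1 h2 h3 h4]]]]]] := two_neighbours cN.
  by apply/set0Pn; exists v1; apply/throughP; exists c1, c.
split; first by rewrite /connectedb B0 conn_through.
- apply/forallP=> K; apply/negP=> /andP[/(clique_star B0)[c cN ->]].
  by rewrite conn_star.
- rewrite -(card_in_imset star_inj); apply/subset_leq_card/subsetP=> _ /imsetP[c cN ->].
  by rewrite inE star_clique.
Qed.

End Star.

(** [C] and its complement in [N :\ j] have at least three elements together, so one of them has
    two; the other one and [j] form [Z]. With two neighbours on each side, both new vertices have
    smaller degree even with the new edge. *)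
Lemma split_choice (V T : finType) (e : rel T) sd (al be : V -> T) x j C :
  3 < #|[set y | e x y]| -> splits e sd al be x j C ->
  exists Z : {set T}, [/\ Z \subset [set y | e x y], 1 < #|Z|,
    1 < #|[set y | e x y] :\: Z| &
    forall v c c', c \in Z -> c' \notin Z -> on e sd al be v x c ->
      on e sd al be v x c' -> c = j].
Proof.
set N := [set y | e x y] => N4 /and5P[jN CN C0 D0 /forall_inP noC].
pose D := (N :\ j) :\: C.
have DN : D \subset N :\ j by apply: subsetDl.
have inN c v : on e sd al be v x c -> c \in N by case/andP=> h _; rewrite inE.
have card2 : #|C| + #|D| = #|N| - 1.
  by rewrite (cardsD1 j N) jN add1n subn1 /= -(cardsID C (N :\ j)) (setIidPr CN).
have main (X Y : {set T}) : X \subset N :\ j -> X != set0 -> Y = (N :\ j) :\: X -> 1 < #|Y| ->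
    (forall v c c', c \in X -> c' \in Y -> ~~ (on e sd al be v x c && on e sd al be v x c')) ->
    exists Z : {set T}, [/\ Z \subset N, 1 < #|Z|, 1 < #|N :\: Z| &
      forall v c c', c \in Z -> c' \notin Z -> on e sd al be v x c ->
      on e sd al be v x c' -> c = j].
  move=> XN X0 YE Y2 noXY; exists (j |: X).
  have jX : j \notin X by apply/negP=> /(subsetP XN); rewrite in_setD1 eqxx.
  split.
  - rewrite subUset sub1set jN; exact: subset_trans XN (subsetDl _ _).
  - by rewrite cardsU1 jX add1n ltnS card_gt0.
  - by rewrite -setDDl -YE.
  - move=> v c c' /setU1P[//|cX]; rewrite in_setU1 negb_or => /andP[c'j c'X] h h'.
    have c'Y : c' \in Y by rewrite YE !in_setD in_set1 c'X c'j (inN _ _ h').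
    by have := noXY v c c' cX c'Y; rewrite h h'.
case: (ltnP 1 #|D|) => hD.
  apply: (main C D) => // v c c' cC c'D.
  by move/forall_inP: (noC c cC) => /(_ c' c'D)/forallP.
apply: (main D C) => //; first by apply/setP=> t; rewrite /D !in_setD in_set1;
    have := subsetP CN t; rewrite in_setD1; case: (t \in C) => [/(_ isT)->|_]; rewrite ?andbF //= andNb.
  by lia.
move=> v c c' cC c'D; rewrite andbC.
by move/forall_inP: (noC c' c'D) => /(_ c cC)/forallP.
Qed.

(** * The tree with a split vertex *)

Section SplitVertex.

Variables (V T : finType) (adj : rel V) (e : rel T).
Variables (sd : T -> T -> pred T) (al be : V -> T).
Hypothesis rep : cut_rep adj e sd al be.
Let cs := rep_cut rep.

Variables (x j : T) (Z : {set T}).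
Hypothesis ZN : Z \subset [set y | e x y].
Hypothesis via_j : forall v c c', c \in Z -> c' \notin Z ->
  on e sd al be v x c -> on e sd al be v x c' -> c = j.

Lemma split_eZ c : c \in Z -> e x c.
Proof. by move/(subsetP ZN); rewrite inE. Qed.

Lemma split_xZ : x \in Z = false.
Proof. by apply/negP=> /split_eZ; rewrite (cut_irr cs). Qed.

(* [Some x] and the new vertex [None] share the neighbours of [x]: those in [Z]
   go to [None]. *)
Definition split_edge : rel (option T) := fun a b =>
  match a, b with
  | Some s, Some t => [&& e s t, ~~ ((s == x) && (t \in Z)) & ~~ ((t == x) && (s \in Z))]
  | None, Some t | Some t, None => (t == x) || (t \in Z)
  | None, None => false
  end.

Definition split_proj : option T -> T := odflt x.

(** [o] is the other end of an edge at [t]: it decides to which copy of [x] the edge is attached. *)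
Definition split_lift (t o : T) : option T :=
  if (t == x) && (o \in Z) then None else Some t.

Definition Zside (t : T) : bool := [exists c in Z, sd x c t].

Definition Zside' (a : option T) : bool := if a is Some t then Zside t else true.

(** For the edges of the new tree, equal projections single out the new edge, whose cut separates
    [None] and the branches of [Z] from the rest; every other edge keeps its old cut. *)
Definition split_sd (a b : option T) : pred (option T) := fun t =>
  if split_proj a == split_proj b then
    (if a is None then ~~ Zside' t else Zside' t)
  else sd (split_proj a) (split_proj b) (split_proj t).

(* A path that ends at [x] must not gain the new edge. *)
Definition split_end (t o : T) : option T :=
  if t == x then (if Zside o then None else Some x) else Some t.

Lemma ZsideP t : reflect (exists2 c, c \in Z & sd x c t) (Zside t).
Proof. exact: exists_inP. Qed.

Lemma Zside_x : Zside x = false.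
Proof.
apply/ZsideP=> -[c cZ].
by rewrite (cut_src cs) // split_eZ.
Qed.

Lemma Zside_edge s t : e s t -> s != x -> t != x -> Zside s = Zside t.
Proof.
move=> est sx tx; apply: eq_existsb => c; case cZ: (c \in Z) => //=.
apply: (cut_neq cs) (split_eZ cZ) est _.
by apply/negP=> /eqP/set2_inj[] [E1 E2]; rewrite ?E1 ?E2 eqxx in sx tx.
Qed.

Lemma Zside_nbr t : e x t -> Zside t = (t \in Z).
Proof.
move=> ext; apply/ZsideP/idP => [[c cZ h]|tZ]; last first.
  by exists t => //; rewrite (cut_dst cs).
have [->//|ne] := eqVneq t c.
have := branch_disjoint cs (split_eZ cZ) ext _ h.
by rewrite (cut_dst cs) // eq_sym => /(_ ne).
Qed.

Lemma split_lift_edge s t : e s t -> split_edge (split_lift s t) (split_lift t s).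
Proof.
rewrite /split_lift => est.
have [sx|sx] := eqVneq s x; have [tx|tx] := eqVneq t x => /=.
- by move: est; rewrite sx tx (cut_irr cs).
- by case tZ: (t \in Z); rewrite /= ?tZ ?orbT // est sx eqxx (negPf tx).
- by case sZ: (s \in Z); rewrite /= ?sZ ?orbT // est tx eqxx (negPf sx).
- by rewrite est (negPf sx) (negPf tx).
Qed.

Lemma split_edge_sym : symmetric split_edge.
Proof.
case=> [s|] [t|] //=; rewrite (cut_sym cs); congr andb; exact: andbC.
Qed.

Lemma split_edgeP a b : split_edge a b ->
  [\/ a = Some x /\ b = None, a = None /\ b = Some x |
   [/\ split_proj a != split_proj b, e (split_proj a) (split_proj b),
    a = split_lift (split_proj a) (split_proj b) &
    b = split_lift (split_proj b) (split_proj a)]].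
Proof.
have neZ t : t \in Z -> t != x by apply: contraTneq => ->; rewrite split_xZ.
case: a b => [s|] [t|] //=.
- move=> /and3P[est h1 h2]; apply: Or33; rewrite /split_lift (negPf h1) (negPf h2).
  by split=> //; apply: contraTneq est => ->; rewrite (cut_irr cs).
- case/orP=> [/eqP->|sZ]; [by apply: Or31|apply: Or33].
  rewrite /split_lift (negPf (neZ _ sZ)) eqxx sZ /=; split=> //.
  by rewrite (cut_sym cs) split_eZ.
- case/orP=> [/eqP->|sZ]; [by apply: Or32|apply: Or33].
  rewrite /split_lift (negPf (neZ _ sZ)) eqxx sZ /=; split=> //.
  - by rewrite eq_sym; exact: (neZ _ sZ).
  - by rewrite split_eZ.
Qed.

Lemma split_connect s t : connect split_edge (Some s) (Some t).
Proof.
have /connectP[p pth ->] := cut_conn cs s t.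
elim: p s pth => [|u p IH] s /=; first by rewrite connect0.
move=> /andP[esu /IH]; apply: connect_trans.
have xN : connect split_edge (Some x) None by apply: connect1; rewrite /= eqxx.
have Nx : connect split_edge None (Some x) by apply: connect1; rewrite /= eqxx.
have L r q : connect split_edge (Some r) (split_lift r q).
  by rewrite /split_lift; case: ifP => [/andP[/eqP-> _]|_] //; exact: connect0.
have L' r q : connect split_edge (split_lift r q) (Some r).
  by rewrite /split_lift; case: ifP => [/andP[/eqP-> _]|_] //; exact: connect0.
apply: connect_trans (L s u) _; apply: connect_trans (L' u s).
exact/connect1/split_lift_edge.
Qed.

Lemma split_cut_system : cut_system split_edge split_sd.
Proof.
split.
- exact: split_edge_sym.
- by case=> [t|] //=; rewrite (cut_irr cs).
- by apply/card_gt0P; exists None.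
- have xN : connect split_edge (Some x) None by apply: connect1; rewrite /= eqxx.
  have Nx : connect split_edge None (Some x) by apply: connect1; rewrite /= eqxx.
  case=> [s|] [t|]; rewrite ?connect0 ?split_connect //.
    exact: connect_trans (split_connect s x) xN.
  exact: connect_trans Nx (split_connect x t).
- move=> a b /split_edgeP[[-> ->]|[-> ->]|[ne eab _ _]]; rewrite /split_sd /= ?eqxx ?Zside_x //.
  by rewrite (negPf ne) (cut_src cs).
- move=> a b /split_edgeP[[-> ->]|[-> ->]|[ne eab _ _]]; rewrite /split_sd /= ?eqxx ?Zside_x //.
  by rewrite (negPf ne) (cut_dst cs).
move=> a b c d /split_edgeP ab /split_edgeP cd.
(* An old edge never crosses the cut of the new edge: the edges at [x] were attached to the copy on
   their own side. *)
have linkE : split_proj c != split_proj d -> e (split_proj c) (split_proj d) ->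
    c = split_lift (split_proj c) (split_proj d) ->
    d = split_lift (split_proj d) (split_proj c) -> Zside' c = Zside' d.
  set s := split_proj c; set t := split_proj d => ne est -> ->; rewrite /split_lift.
  have [sx|sx] := eqVneq s x; have [tx|tx] := eqVneq t x => /=.
  - by rewrite sx tx eqxx in ne.
  - have ext : e x t by rewrite -sx.
    by case: ifP => /= tZ; rewrite ?sx ?Zside_x Zside_nbr // tZ.
  - have exs : e x s by rewrite -tx (cut_sym cs).
    by case: ifP => /= sZ; rewrite ?tx ?Zside_x Zside_nbr // sZ.
  - exact: Zside_edge.
case: ab => [[-> ->]|[-> ->]|[ne eab aE bE]]; rewrite /split_sd /= ?eqxx.
- case: cd => [[-> ->]|[-> ->]|[ne est cE dE]]; [by left|by right|].
  by rewrite (linkE ne est cE dE) eqxx.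
- case: cd => [[-> ->]|[-> ->]|[ne est cE dE]]; [by right|by left|].
  by rewrite (linkE ne est cE dE) eqxx.
rewrite (negPf ne) => h.
case: cd => [[E1 E2]|[E1 E2]|[_ ecd cE dE]]; try by rewrite E1 E2 eqxx in h.
by case: (cut_cross cs eab ecd h) => -[E1 E2]; [left|right]; split;
  rewrite E1 E2 in cE dE; rewrite ?cE ?dE.
Qed.

Let al' v := split_end (al v) (be v).
Let be' v := split_end (be v) (al v).

Lemma split_proj_end t o : split_proj (split_end t o) = t.
Proof. by rewrite /split_end; have [->|//] := eqVneq t x; case: ifP. Qed.

Lemma on_split_lift v s t : e s t ->
  on split_edge split_sd al' be' v (split_lift s t) (split_lift t s) = on e sd al be v s t.
Proof.
have pl r q : split_proj (split_lift r q) = r.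
  by rewrite /split_lift; case: ifP => [/andP[/eqP->]|].
move=> est; rewrite /on /sep est /=.
rewrite split_lift_edge //= /split_sd !pl.
have ne : s != t by apply: contraTneq est => ->; rewrite (cut_irr cs).
by rewrite (negPf ne) !split_proj_end.
Qed.

(** A path on the new edge ends in a branch of [Z] and in a branch outside [Z], so [via_j] applies
    to it. A path with an end at [x] is excluded, since that end was moved to the side of the other
    one. *)
Lemma on_split_link v a b : split_proj a = split_proj b ->
  on split_edge split_sd al' be' v a b -> on e sd al be v x j.
Proof.
move=> E /andP[eab]; rewrite /split_sd E eqxx.
have Z' t o : Zside' (split_end t o) = if t == x then Zside o else Zside t.
  by rewrite /split_end; case: ifP => //; case: ifP => //= _; rewrite Zside_x.
have main u w : sep e sd u w x j = sep e sd w u x j.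
  by rewrite /sep eq_sym.
have key u w : (forall c c', c \in Z -> c' \notin Z -> sep e sd u w x c ->
     sep e sd u w x c' -> c = j) -> w != x -> Zside u -> ~~ Zside w -> sep e sd u w x j.
  move=> via wx /ZsideP[c cZ hu] nw.
  have exc := split_eZ cZ.
  have [c' exc' hw] := branch_exists cs wx.
  have c'Z : c' \notin Z.
    by apply: contra nw => c'Z; apply/ZsideP; exists c'.
  have cw : sd x c w = false.
    by apply/negP=> h; case/negP: nw; apply/ZsideP; exists c.
  have cc' : c != c' by apply: contraNneq c'Z => <-.
  have s1 : sep e sd u w x c by rewrite /sep exc hu cw.
  have s2 : sep e sd u w x c'.
    by rewrite /sep exc' hw (branch_disjoint cs exc exc' cc' hu).
  by rewrite -(via c c').
have : Zside' (al' v) != Zside' (be' v) -> on e sd al be v x j.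
  rewrite /al' /be' !Z'.
  have [ax|ax] := eqVneq (al v) x; have [bx|bx] := eqVneq (be v) x; rewrite ?eqxx //.
    by rewrite ax bx eqxx.
  case za: (Zside (al v)); case zb: (Zside (be v)) => // _.
    by apply: key; rewrite ?zb // => c c'; apply: via_j.
  rewrite /on main; apply: key; rewrite ?za // => c c' h1 h2 h3 h4.
  by apply: (via_j (v := v) h1 h2); rewrite /on /sep eq_sym.
by case: a {E eab} => [t|]; case: (Zside' (al' v)); case: (Zside' (be' v)) => // h _; apply: h.
Qed.

(** Paths sharing an edge in one tree share one in the other: old edges correspond to their lifts,
    and the new edge is answered by [xj]. *)
Lemma split_rep : cut_rep adj split_edge split_sd al' be'.
Proof.
have up a b : exists a' b', forall v, on e sd al be v a b ->
    on split_edge split_sd al' be' v a' b'.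
  exists (split_lift a b), (split_lift b a) => v h.
  by rewrite on_split_lift //; case/andP: h.
have down a b : exists a' b', forall v, on split_edge split_sd al' be' v a b ->
    on e sd al be v a' b'.
  have [E|ne] := eqVneq (split_proj a) (split_proj b).
    by exists x, j => v; apply: on_split_link.
  exists (split_proj a), (split_proj b) => v h; have /andP[/split_edgeP hab _] := h.
  case: hab => [[E1 E2]|[E1 E2]|[_ eab aE bE]]; try by rewrite E1 E2 eqxx in ne.
  by rewrite -on_split_lift // -aE -bE.
have meetsE u v : meets e sd al be u v <-> meets split_edge split_sd al' be' u v.
  split=> -[a [b [hu hv]]].
    by have [a' [b' h]] := up a b; exists a', b'; split; apply: h.
  by have [a' [b' h]] := down a b; exists a', b'; split; apply: h.
split; first exact: split_cut_system.
  by move=> u v uv; rewrite -meetsE; apply: (rep_adj rep uv).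
move=> S S0 pS; have [|a [b ab]] := rep_helly rep S0.
  by move=> u v uS vS; apply/meetsE/pS.
by have [a' [b' h]] := up a b; exists a', b' => v vS; apply/h/ab.
Qed.

Lemma split_degree_None : #|[set b | split_edge None b]| <= #|Z|.+1.
Proof.
have -> : #|Z|.+1 = #|x |: Z| by rewrite cardsU1 split_xZ.
apply: leq_trans (leq_imset_card Some _).
apply/subset_leq_card/subsetP=> -[t|]; rewrite inE //= => h.
by apply/imsetP; exists t; rewrite // in_setU1.
Qed.

Lemma split_degree_x :
  #|[set b | split_edge (Some x) b]| <= #|[set y | e x y] :\: Z|.+1.
Proof.
set D := _ :\: Z.
apply: (@leq_trans #|None |: [set Some t | t in D]|); last first.
  by rewrite cardsU1 -add1n leq_add ?leq_b1 ?leq_imset_card.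
apply/subset_leq_card/subsetP=> -[t|]; rewrite ?setU11 // !inE /= eqxx /=.
move=> /and3P[ext tZ _]; apply/imsetP; exists t => //.
by rewrite in_setD tZ inE.
Qed.

Lemma split_degree_other t : t != x ->
  #|[set b | split_edge (Some t) b]| <= #|[set y | e t y]|.
Proof.
move=> tx; apply: leq_trans (leq_imset_card (fun s => split_lift s t) _).
apply/subset_leq_card/subsetP=> b; rewrite inE => /split_edgeP.
case=> [[[E]]|[//]|[_ etb _ bE]]; first by rewrite E eqxx in tx.
by apply/imsetP; exists (split_proj b); rewrite // inE.
Qed.

End SplitVertex.

(** * Repeated splitting, with the total excess of degrees as measure *)

Definition excess (T : finType) (e : rel T) (h : nat) : nat :=
  \sum_x (#|[set y | e x y]| - h).

Lemma excess_split (T : finType) (e : rel T) (e' : rel (option T)) x h z d :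
  2 < h -> 1 < z -> 1 < d -> h < z + d -> #|[set y | e x y]| = z + d ->
  #|[set b | e' None b]| <= z.+1 -> #|[set b | e' (Some x) b]| <= d.+1 ->
  (forall t, t != x -> #|[set b | e' (Some t) b]| <= #|[set y | e t y]|) ->
  excess e' h < excess e h.
Proof.
move=> h2 z1 d1 hzd E dN dx dt.
rewrite /excess (bigD1 None) //= (reindex_omap Some id) /=; last by case.
rewrite (eq_bigl xpredT) => [|t]; last by rewrite /= eqxx.
rewrite (bigD1 x) //= [in ltnRHS](bigD1 x) //= E addnA.
have le : \sum_(i | i != x) (#|[set b | e' (Some i) b]| - h) <=
    \sum_(i | i != x) (#|[set y | e i y]| - h).
  by apply: leq_sum => i ix; apply: leq_sub2r; apply: dt.
rewrite -addSn; apply: leq_add le.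
apply: leq_ltn_trans (leq_add (leq_sub2r h dN) (leq_sub2r h dx)) _; lia.
Qed.

Lemma bounded_degree_rep (V : finType) (adj : rel V) (h : nat) :
  2 < h -> (forall A, atom adj A -> ncliques adj A <= h) ->
  forall (T : finType) (e : rel T) sd (al be : V -> T), cut_rep adj e sd al be ->
  exists (T' : finType) (e' : rel T') sd' (al' be' : V -> T'),
    max_degree_le e' h /\ cut_rep adj e' sd' al' be'.
Proof.
move=> h2 atoms T e; have [n] := ubnP (excess e h).
elim: n T e => // n IH T e ltn sd al be rep.
case: (boolP [forall x, #|[set y | e x y]| <= h]) => [/forallP deg|].
  by exists T, e, sd, al, be.
rewrite negb_forall => /existsP[x]; rewrite -ltnNge => dx.
case: (boolP [exists j, exists C, splits e sd al be x j C]) => [|nos].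
  case/existsP=> j /existsP[C] /split_choice[|Z [ZN Z2 D2 via]].
    exact: leq_trans dx.
  have rep' := split_rep rep ZN via.
  apply: IH rep'; apply: (@leq_trans (excess e h)); last by [].
  have cE : #|[set y | e x y]| = #|Z| + #|[set y | e x y] :\: Z|.
    by rewrite -(cardsID Z [set y | e x y]) (setIidPr ZN).
  apply: (excess_split h2 Z2 D2 _ cE); first by rewrite -cE.
  - exact: (split_degree_None rep ZN).
  - exact: split_degree_x.
  - by move=> t; exact: (split_degree_other rep ZN).
have nos' j C : ~~ splits e sd al be x j C.
  by apply: contra nos => h0; apply/existsP; exists j; apply/existsP; exists C.
have [conB sepB cardB] := star_atom rep (leq_ltn_trans h2 dx) nos'.
have ok : connectedb adj (through e sd al be x) && no_clique_sep adj (through e sd al be x).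
  by rewrite conB.
have [A atA BA] := @maxset_exists _ (fun B => connectedb adj B && no_clique_sep adj B) _ ok.
have := leq_trans cardB (leq_trans (ncliquesS adj BA) (atoms A atA)).
by rewrite leqNgt dx.
Qed.

Theorem theorem13 (V : finType) (adj : rel V) :
  symmetric adj -> irreflexive adj -> helly_EPT adj ->
  forall h : nat, 3 <= h ->
  (helly_h22 h adj <-> (forall A : {set V}, atom adj A -> ncliques adj A <= h)).
Proof.
move=> _ adjI [T0 [e0 [P0 [tr0 rep0 helly0]]]] h h3; split.
- move=> [T [e [P [tr deg ept helly]]]] A /maxsetP[/andP[conA sepA] _].
  have [sd [al [be rep]]] := cut_rep_of_tree tr ept helly.
  have [|many] := leqP (ncliques adj A) 1; first by move/leq_trans; apply; lia.
  have [x hx] := ncliques_le_degree adjI rep conA sepA many.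
  exact: leq_trans hx (deg x).
- move=> atoms; have [sd [al [be rep]]] := cut_rep_of_tree tr0 rep0 helly0.
  have [T [e [sd' [al' [be' [deg rep']]]]]] := bounded_degree_rep h3 atoms rep.
  have [tr [P [ept helly]]] := tree_of_cut_rep rep'.
  by exists T, e, P.
Qed.
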